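(* Let $L := B(2\pi)\cap\{y_1=y_2=0\}$ and $\mathcal{C} := \mathcal{E}(\pi,4\pi)\cap\{x_2=y_2=0\}$. Then $B(2\pi)\setminus L$ is symplectomorphic to $\mathcal{E}(\pi,4\pi)\setminus\mathcal{C}$. Consequently, $B(2\pi)\setminus L$ symplectically embeds into $Z(\pi)$.
   Context: $\mathbb{R}^4$ has coordinates $(x_1,y_1,x_2,y_2)$ and the standard symplectic form $\omega = dx_1\wedge dy_1+dx_2\wedge dy_2$; open subsets carry the restricted form. A symplectic embedding is a smooth embedding $\Phi$ with $\Phi^*\omega=\omega$. $B(\pi R^2)\subset\mathbb{R}^4$ denotes the open ball of radius $R$ centered at the origin (so $B(2\pi)$ has radius $\sqrt 2$), and $Z(\pi r^2)=\{x_1^2+y_1^2<r^2\}\subset\mathbb{R}^4$ is the open cylinder of radius $r$. $\mathcal{E}(\pi,4\pi)$ is the open ellipsoid $\{(x_1,y_1,x_2,y_2) : x_1^2+y_1^2+\frac{x_2^2+y_2^2}{4}<1\}$. *)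

(* Defs.v *)
From HB Require Import structures.
From mathcomp Require Import all_boot all_order all_algebra.
From mathcomp Require Import all_classical all_reals all_analysis.

Set Implicit Arguments.
Unset Strict Implicit.
Unset Printing Implicit Defensive.

Import Order.TTheory GRing.Theory Num.Theory.
Import numFieldNormedType.Exports.

Local Open Scope classical_set_scope.
Local Open Scope ring_scope.

(* Maps defined on an open set U are represented by total functions of which
   only the restriction to U matters: for U open, differentiability and the
   differential at a point of U depend only on that restriction. The predicates
   below are meant for open U. *)

(* C^(k+1) on U: differentiable on U, with x |-> df_x(v) of class C^k on U for
   each v (in finite dimension this says that x |-> df_x is of class C^k). *)
Fixpoint Ck_on (R : realType) (V W : normedModType R) (k : nat)
    (U : set V) (f : V -> W) : Prop :=
  if k is k'.+1 then
    (forall x, U x -> differentiable f x) /\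
    (forall v : V, Ck_on k' U (fun x => 'd f x v))
  else forall x, U x -> {for x, continuous f}.

Definition smooth_on (R : realType) (V W : normedModType R)
    (U : set V) (f : V -> W) : Prop :=
  forall k, Ck_on k U f.

(* An injective immersion that is a homeomorphism onto its image. *)
Definition smooth_embedding (R : realType) (V W : normedModType R)
    (U : set V) (f : V -> W) : Prop :=
  [/\ smooth_on U f,
      forall x, U x -> injective ('d f x),
      {in U &, injective f}
    & exists g : W -> V,
        {within f @` U, continuous g} /\ (forall x, U x -> g (f x) = x)].

Section R4.
Variable R : realType.
Local Notation R4 := 'rV[R]_4.

Definition x1 (p : R4) : R := p 0 (@Ordinal 4 0 isT).
Definition y1 (p : R4) : R := p 0 (@Ordinal 4 1 isT).
Definition x2 (p : R4) : R := p 0 (@Ordinal 4 2 isT).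
Definition y2 (p : R4) : R := p 0 (@Ordinal 4 3 isT).

(* The coordinates are linear, hence equal to their own differentials. *)
Definition wedge (a b : R4 -> R) (u v : R4) : R := a u * b v - a v * b u.

Definition omega (u v : R4) : R := wedge x1 y1 u v + wedge x2 y2 u v.

Definition preserves_omega (U : set R4) (Phi : R4 -> R4) : Prop :=
  forall p, U p -> forall u v : R4, omega ('d Phi p u) ('d Phi p v) = omega u v.

Definition symplectically_embeds (U V : set R4) : Prop :=
  exists Phi : R4 -> R4,
    [/\ smooth_embedding U Phi, Phi @` U `<=` V & preserves_omega U Phi].

Definition symplectomorphic (U V : set R4) : Prop :=
  exists Phi Psi : R4 -> R4,
    [/\ smooth_on U Phi /\ smooth_on V Psi,
        Phi @` U `<=` V /\ Psi @` V `<=` U,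
        {in U, cancel Phi Psi} /\ {in V, cancel Psi Phi}
      & preserves_omega U Phi].

(* The parameters are areas: a = pi r^2, so a / pi is a squared radius. *)
Definition ball4 (a : R) : set R4 :=
  [set p | x1 p ^+ 2 + y1 p ^+ 2 + x2 p ^+ 2 + y2 p ^+ 2 < a / pi].

Definition cylinder (a : R) : set R4 :=
  [set p | x1 p ^+ 2 + y1 p ^+ 2 < a / pi].

Definition ellipsoid (a b : R) : set R4 :=
  [set p | (x1 p ^+ 2 + y1 p ^+ 2) / (a / pi)
           + (x2 p ^+ 2 + y2 p ^+ 2) / (b / pi) < 1].

Definition lagrangian_disk : set R4 :=
  ball4 (2 * pi) `&` [set p | y1 p = 0 /\ y2 p = 0].

Definition symplectic_disk : set R4 :=
  ellipsoid pi (4 * pi) `&` [set p | x2 p = 0 /\ y2 p = 0].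

Lemma ball4E : ball4 (2 * pi) =
  [set p | x1 p ^+ 2 + y1 p ^+ 2 + x2 p ^+ 2 + y2 p ^+ 2 < 2].
Proof. by rewrite /ball4 mulfK ?gt_eqF ?pi_gt0. Qed.

Lemma cylinderE : cylinder pi = [set p | x1 p ^+ 2 + y1 p ^+ 2 < 1].
Proof. by rewrite /cylinder divff ?gt_eqF ?pi_gt0. Qed.

Lemma ellipsoidE : ellipsoid pi (4 * pi) =
  [set p | x1 p ^+ 2 + y1 p ^+ 2 + (x2 p ^+ 2 + y2 p ^+ 2) / 4 < 1].
Proof.
by rewrite /ellipsoid divff ?mulfK ?gt_eqF ?pi_gt0 //; under eq_fun do rewrite divr1.
Qed.

Lemma coord_sqr_continuous (i : 'I_4) : continuous (fun p : R4 => p 0 i ^+ 2).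
Proof.
move=> p; apply: (@continuous_comp _ _ _ (fun q : R4 => q 0 i) (fun z => z ^+ 2)).
  exact: coord_continuous.
exact: exprn_continuous.
Qed.

Lemma open_lt4 (f : R4 -> R) (c : R) : continuous f -> open [set p | f p < c].
Proof.
move=> cf; apply: (@open_comp _ _ f [set z | z < c]); last exact: open_lt.
by move=> p _; exact: cf.
Qed.

Lemma open_coords_neq0 (i j : 'I_4) :
  open (~` [set p : R4 | p 0 i = 0 /\ p 0 j = 0]).
Proof.
have o k : open [set p : R4 | p 0 k != 0].
  apply: (@open_comp _ _ (fun p : R4 => p 0 k) [set z | z != 0]).
    by move=> p _; exact: coord_continuous.
  exact: open_neq.
have -> : ~` [set p : R4 | p 0 i = 0 /\ p 0 j = 0] =
          [set p : R4 | p 0 i != 0] `|` [set p : R4 | p 0 j != 0].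
  apply/seteqP; split=> p /=.
    by move/not_andP => -[/eqP|/eqP]; [left|right].
  by move=> [/eqP h []|/eqP h []].
exact: openU.
Qed.

Lemma open_ball4_minus_disk : open (ball4 (2 * pi) `\` lagrangian_disk).
Proof.
rewrite /lagrangian_disk setDIr setDv set0U setDE.
apply: openI; last exact: open_coords_neq0.
apply: open_lt4 => p.
have c4 := coord_sqr_continuous.
exact: (continuousD (continuousD (continuousD (c4 _ _) (c4 _ _)) (c4 _ _))
  (c4 _ _)).
Qed.

Lemma open_ellipsoid_minus_disk :
  open (ellipsoid pi (4 * pi) `\` symplectic_disk).
Proof.
rewrite /symplectic_disk setDIr setDv set0U setDE.
apply: openI; last exact: open_coords_neq0.
apply: open_lt4 => p.
have c4 := coord_sqr_continuous.
have cl (a : R) i j : {for p, continuous (fun q : R4 => (q 0 i ^+ 2 + q 0 j ^+ 2) / a)}.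
  apply: (@continuousM _ _ (fun q : R4 => q 0 i ^+ 2 + q 0 j ^+ 2) (fun=> a^-1)).
    exact: (continuousD (c4 _ _) (c4 _ _)).
  exact: cst_continuous.
exact: (continuousD (cl _ _ _) (cl _ _ _)).
Qed.

End R4.

(* Main.v *)
From HB Require Import structures.
Require Import Defs.
From mathcomp Require Import all_boot all_order all_algebra ring lra.
From mathcomp Require Import all_classical all_reals all_analysis.

(** Write y = y1 + i y2 and x = x1 + i x2 on the ball, and let rho = |y|^2,
dot = x1 y1 + x2 y2, ang = x1 y2 - x2 y1 and
mu = sqrt (2 rho - rho^2 - dot^2).

The geometric reason for the theorem: adding a line at infinity turns the ball
into CP^2, and L into RP^2.  The rotation group SO(3) acts on CP^2 with moment
map M = X x Y, the cross product of the real and imaginary parts of the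
homogeneous coordinates Z normalised by |Z|^2 = 2; it vanishes exactly on RP^2.
In the chart of the ball, where Z = (sqrt (2 - |z1|^2 - |z2|^2), z1, z2), the
length of M is mu and its component along the first axis is ang.  Off RP^2 the
function mu is smooth, and its flow is the rotation about M, which closes up
after time pi because the half turn acts on the plane orthogonal to M by -1.
Hence mu / 2 and ang generate a torus action there.  The line at infinity is
where ang = mu or ang = - mu, and RP^2 is where mu = 0, so the pair (mu, ang)
maps the ball minus L onto the region |ang| < mu <= 1.  Under r1 = 1 - mu,
r2 = 2 (mu + ang) this region becomes 0 <= r1, 0 < r2, r1 + r2 / 4 < 1, the
moment triangle of the ellipsoid without the edge r2 = 0 that carries C.

Matching the angles too makes the symplectomorphism explicit.  With
y = sqrt rho e^(i phi) it sends the point to (w1, w2), wj = xj + i yj, where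
  w2 = sqrt (2 (mu + ang)) e^(- i phi),    w1 = h e^(- 2 i phi),
  h = (mu^2 - rho + i mu dot) / (rho sqrt (1 + mu)),    |h|^2 = 1 - mu.
The inverse is read off from this: w1 and w2 give mu, ang, phi and h; then the
real part of h gives rho, the imaginary part gives dot, and
x = (dot - i ang) y / rho.

It is symplectic for the following reason.  In the coordinates
(dot, rho, ang, phi),
  omega = d dot ^ d rho / (2 rho) - d ang ^ d phi        ([wedge_polar]).
On the other side, w2 contributes - d (mu + ang) ^ d phi ([wedge_amp]) and
w1 contributes the area form of h plus d mu ^ d phi ([wedge_twist]); and the
area form of h is d dot ^ d rho / (2 rho) ([wedge_profile]).

All functions involved are built from coordinates by field operations with
nonzero denominators and by square roots of positive functions, so smoothness
follows from closure properties of C^k.  The embedding into the cylinder comes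
from r1 < 1 on the ellipsoid; a symplectic map is an immersion because omega is
nondegenerate. *)

Set Implicit Arguments.
Unset Strict Implicit.
Unset Printing Implicit Defensive.

Import Order.TTheory GRing.Theory Num.Theory.
Import numFieldNormedType.Exports.

Local Open Scope classical_set_scope.
Local Open Scope ring_scope.

(** * Closure properties of the class C^k *)

Lemma fun_eq_at (T T' : Type) (f g : T -> T') : f = g -> forall v, f v = g v.
Proof. by move=> ->. Qed.

Section Calculus.
Context {R : realType} {V W : normedModType R}.
Implicit Types (U : set V) (f g : V -> W).

(** The differential is local; this is what lets the formulas for derivatives,
valid only on [U], be substituted inside [Ck_on]. *)
Lemma near_eq_diff f g x : (\forall z \near x, f z = g z) ->
  differentiable f x -> differentiable g x /\ 'd g x = 'd f x :> (V -> W).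
Proof.
move=> fg df.
have fgx : f x = g x by exact: nbhs_singleton fg.
have dg : g \o shift x = cst (g x) + 'd f x +o_ 0 id.
  apply/eqaddoP => e e0.
  have /eqaddoP /(_ e e0) := diff_locally df.
  have : \forall z \near 0, f (z + x) = g (z + x).
    by rewrite (near_shift x) sub0r; near do rewrite /= subrK.
  by apply: filterS2 => z; rewrite !fctE /= => ->; rewrite -fgx.
have E : 'd g x = 'd f x :> (V -> W).
  by apply: diff_unique => //; exact: diff_continuous.
split=> //; apply/diff_locallyP; rewrite E; split=> //.
exact: diff_continuous.
Unshelve. all: by end_near. Qed.

Lemma Ck_on_ext k U f g : open U -> (forall x, U x -> f x = g x) ->
  Ck_on k U f -> Ck_on k U g.
Proof.
move=> oU; have nU x : U x -> \forall z \near x, U z.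
  by move=> Ux; apply: open_nbhs_nbhs; split.
elim: k f g => [|k IH] f g fg /=.
  move=> cf x Ux; rewrite /prop_for /continuous_at -fg//.
  apply: cvg_trans (cf x Ux); apply: near_eq_cvg.
  by near do apply: fg; apply: nU.
move=> [df dCf].
have dfg x (Ux : U x) : differentiable g x /\ 'd g x = 'd f x :> (V -> W).
  by apply: near_eq_diff (df x Ux); near do apply: fg; apply: nU.
split=> [x Ux|v]; first by have [] := dfg x Ux.
by apply: IH (dCf v) => x Ux; exact/esym/(fun_eq_at (dfg x Ux).2).
Unshelve. all: by end_near. Qed.

Lemma Ck_onW k U f : Ck_on k.+1 U f -> Ck_on k U f.
Proof.
elim: k f => [|k IH] f /= [df dCf].
  by move=> x Ux; apply: differentiable_continuous; exact: df.
by split=> // v; apply: IH.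
Qed.

Lemma Ck_on_diff k U f : Ck_on k.+1 U f -> forall x, U x -> differentiable f x.
Proof. by case. Qed.

Lemma Ck_on_cst k U (c : W) : Ck_on k U (cst c).
Proof.
elim: k c => [|k IH] c /=; first by move=> x _; exact: cst_continuous.
split=> [x _|v]; first exact: differentiable_cst.
by under eq_fun do rewrite diff_cst; exact: IH.
Qed.

Lemma Ck_on_linear k U (f : {linear V -> W}) : continuous f -> Ck_on k U f.
Proof.
move=> cf; case: k => [|k] /=; first by move=> x _; exact: cf.
split=> [x _|v]; first exact: linear_differentiable.
by under eq_fun do rewrite diff_lin //; exact: Ck_on_cst.
Qed.

Lemma Ck_onD k U f g : open U -> Ck_on k U f -> Ck_on k U g ->
  Ck_on k U (fun x => f x + g x).
Proof.
move=> oU; elim: k f g => [|k IH] f g.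
  by move=> cf cg x Ux; apply: continuousD; [exact: cf|exact: cg].
move=> [df Cf] [dg Cg]; split=> [x Ux|v].
  by apply: differentiableD; [exact: df|exact: dg].
apply: (@Ck_on_ext _ _ (fun x => 'd f x v + 'd g x v)) => //; last exact: IH (Cf v) (Cg v).
by move=> x Ux; exact/esym/(fun_eq_at (diffD (df x Ux) (dg x Ux))).
Qed.

Lemma Ck_onZl k U (a : V -> R) (w : W) : open U -> Ck_on k U a ->
  Ck_on k U (fun x => a x *: w).
Proof.
move=> oU; elim: k a => [|k IH] a.
  move=> ca x Ux; apply: (@continuous_comp _ _ _ a ( *:%R^~ w)); first exact: ca.
  exact: scalel_continuous.
move=> [da Ca]; split=> [x Ux|v].
  by apply: differentiableZl; exact: da.
apply: (@Ck_on_ext _ _ (fun x => 'd a x v *: w)) => //; last exact: IH (Ca v).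
by move=> x Ux; exact/esym/(fun_eq_at (diffZl w (da x Ux))).
Qed.

End Calculus.

Section RealValued.
Context {R : realType} {V : normedModType R}.
Implicit Types (U : set V) (a b : V -> R).

(** The Leibniz rule expresses the differential of the product through functions
of one class lower, so the induction on [k] must run over both factors. *)
Lemma Ck_onM k U a b : open U -> Ck_on k U a -> Ck_on k U b ->
  Ck_on k U (fun x => a x * b x).
Proof.
move=> oU; elim: k a b => [|k IH] a b.
  by move=> ca cb x Ux; apply: continuousM; [exact: ca|exact: cb].
move=> Ca Cb; have [da Cda] := Ca; have [db Cdb] := Cb.
split=> [x Ux|v]; first by apply: differentiableM; [exact: da|exact: db].
apply: (@Ck_on_ext _ _ _ _ _ (fun x => a x * 'd b x v + b x * 'd a x v)) => //.
  by move=> x Ux; exact/esym/(fun_eq_at (diffM (da x Ux) (db x Ux))).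
exact: (Ck_onD oU (IH _ _ (Ck_onW Ca) (Cdb v)) (IH _ _ (Ck_onW Cb) (Cda v))).
Qed.

(** Here and for the square root, the derivative involves the function itself,
which is of class C^k by induction, and the differential of [a]. *)
Lemma Ck_onV k U a : open U -> (forall x, U x -> a x != 0) -> Ck_on k U a ->
  Ck_on k U (fun x => (a x)^-1).
Proof.
move=> oU a0; elim: k => [|k IH].
  by move=> ca x Ux; apply: continuousV; [exact: a0|exact: ca].
move=> Ca; have [da Cda] := Ca; have CV := IH (Ck_onW Ca).
split=> [x Ux|v]; first by apply: differentiableV; [exact: da|exact: a0].
apply: (@Ck_on_ext _ _ _ _ _ (fun x => ((- 1) * ((a x)^-1 * (a x)^-1)) * 'd a x v)) => //.
  move=> x Ux; apply/esym; rewrite mulN1r -invfM -expr2.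
  exact: (fun_eq_at (diffV (da x Ux) (a0 x Ux))).
exact: (Ck_onM oU (Ck_onM oU (Ck_on_cst _ _ _) (Ck_onM oU CV CV)) (Cda v)).
Qed.

Lemma Ck_onX2 k U a : open U ->
  Ck_on k U a -> Ck_on k U (fun q => a q ^+ 2).
Proof. by move=> oU ca; under eq_fun do rewrite expr2; exact: Ck_onM. Qed.

Lemma Ck_onN k U a : open U ->
  Ck_on k U a -> Ck_on k U (fun q => - a q).
Proof.
move=> oU ca; under eq_fun do rewrite -mulN1r.
exact: (Ck_onM oU (Ck_on_cst _ _ (-1 : R)) ca).
Qed.

Lemma Ck_onB k U a b : open U ->
  Ck_on k U a -> Ck_on k U b -> Ck_on k U (fun q => a q - b q).
Proof. by move=> oU ca cb; exact: (Ck_onD oU ca (Ck_onN oU cb)). Qed.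

Lemma Ck_on_div k U a b : open U ->
  (forall x, U x -> b x != 0) ->
  Ck_on k U a -> Ck_on k U b -> Ck_on k U (fun q => a q / b q).
Proof. by move=> oU b0 ca cb; exact: (Ck_onM oU ca (Ck_onV oU b0 cb)). Qed.

Lemma diff_sqrt a x : 0 < a x -> differentiable a x ->
  differentiable (fun z => Num.sqrt (a z)) x /\
  'd (fun z => Num.sqrt (a z)) x =
    (fun v => (2 * Num.sqrt (a x))^-1 * 'd a x v) :> (V -> R).
Proof.
move=> a0 da.
have [ds E] := is_derive1_sqrt a0.
have dS : differentiable (@Num.sqrt R) (a x) by apply/derivable1_diffP.
split; first exact: (differentiable_comp da dS).
apply/funext => v; apply: (etrans (fun_eq_at (diff_comp da dS) v)) => /=.
apply: (etrans (fun_eq_at (diff1E dS) _)).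
by rewrite derive1E E [LHS]mulrC.
Qed.

Lemma Ck_on_sqrt k U a : open U -> (forall x, U x -> 0 < a x) -> Ck_on k U a ->
  Ck_on k U (fun x => Num.sqrt (a x)).
Proof.
move=> oU a0; elim: k => [|k IH].
  move=> ca x Ux; apply: (@continuous_comp _ _ _ a); first exact: ca.
  exact: sqrt_continuous.
move=> Ca; have [da Cda] := Ca; have CS := IH (Ck_onW Ca).
have s0 x : U x -> Num.sqrt (a x) != 0.
  by move=> Ux; rewrite gt_eqF// sqrtr_gt0 a0.
split=> [x Ux|v]; first by have [] := diff_sqrt (a0 x Ux) (da x Ux).
apply: (@Ck_on_ext _ _ _ _ _ (fun x => (2 * Num.sqrt (a x))^-1 * 'd a x v)) => //.
  by move=> x Ux; exact/esym/(fun_eq_at (diff_sqrt (a0 x Ux) (da x Ux)).2).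
have n0 x : U x -> 2 * Num.sqrt (a x) != 0 by move=> Ux; rewrite mulf_neq0 ?s0.
exact: (Ck_onM oU (Ck_onV oU n0 (Ck_onM oU (Ck_on_cst _ _ (2 : R)) CS)) (Cda v)).
Qed.

Lemma Ck_on_sum {W : normedModType R} k U (I : Type) (s : seq I) (F : I -> V -> W) :
  open U -> (forall i, Ck_on k U (F i)) ->
  Ck_on k U (fun x => \sum_(i <- s) F i x).
Proof.
move=> oU CF; elim: s => [|i s IH].
  under eq_fun do rewrite big_nil; exact: Ck_on_cst.
under eq_fun do rewrite big_cons; exact: (Ck_onD oU (CF i) IH).
Qed.

Lemma Ck_on_row k n U (f : V -> 'rV[R]_n) : open U ->
  (forall i, Ck_on k U (fun x => f x 0 i)) -> Ck_on k U f.
Proof.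
move=> oU CF.
rewrite (_ : f = (fun x => \sum_i f x 0 i *: delta_mx 0 i)).
  exact: (Ck_on_sum _ oU (fun i => Ck_onZl _ oU (CF i))).
by apply/funext => x; exact: row_sum_delta.
Qed.

End RealValued.

Section Coordinates.
Context {R : realType} {n : nat}.

Lemma coord_linear i : linear (fun x : 'rV[R]_n => x 0 i).
Proof. by move=> a u v; rewrite !mxE. Qed.

Let coord i : {linear 'rV[R]_n -> R} :=
  HB.pack (fun x : 'rV[R]_n => x 0 i) (GRing.isLinear.Build _ _ _ _ _ (coord_linear i)).

Lemma Ck_on_coord k (U : set 'rV[R]_n) i : Ck_on k U (fun x => x 0 i : R).
Proof. exact: (@Ck_on_linear _ _ _ k U (coord i) (@coord_continuous _ _ _ _ _)). Qed.

Lemma diff_coord (x v : 'rV[R]_n) i : 'd (fun q : 'rV[R]_n => q 0 i) x v = v 0 i.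
Proof. exact: (fun_eq_at (@diff_lin _ _ _ (coord i) x (@coord_continuous _ _ _ _ _)) v). Qed.

Lemma diff_row (V : normedModType R) (f : V -> 'rV[R]_n) x v i :
  differentiable f x -> 'd f x v 0 i = 'd (fun q => f q 0 i) x v.
Proof.
move=> df; have dc := differentiable_coord (f x) 0 i.
apply/esym/(etrans (fun_eq_at (diff_comp df dc) v)); exact: diff_coord.
Qed.

End Coordinates.

(** * Directional derivatives of real functions *)

Section Directional.
Context {R : realType} {V : normedModType R}.
Implicit Types (a b : V -> R) (x v : V).

(** Bundling differentiability with the value lets one term compute the derivative
of a compound expression. *)
Definition has_diff a x v l := differentiable a x /\ 'd a x v = l.

Lemma has_diffD a b x v l m : has_diff a x v l -> has_diff b x v m ->
  has_diff (fun q => a q + b q) x v (l + m).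
Proof.
move=> [da <-] [db <-]; split; first exact: differentiableD.
exact: (fun_eq_at (diffD da db)).
Qed.

Lemma has_diffN a x v l : has_diff a x v l -> has_diff (fun q => - a q) x v (- l).
Proof.
move=> [da <-]; split; first exact: differentiableN.
exact: (fun_eq_at (diffN da)).
Qed.

Lemma has_diffM a b x v l m : has_diff a x v l -> has_diff b x v m ->
  has_diff (fun q => a q * b q) x v (a x * m + b x * l).
Proof.
move=> [da <-] [db <-]; split; first exact: differentiableM.
exact: (fun_eq_at (diffM da db)).
Qed.

Lemma has_diff_cst c x v : has_diff (fun=> c) x v 0.
Proof.
by split; [exact: differentiable_cst|exact: (fun_eq_at (@diff_cst _ _ _ c x) v)].
Qed.

Lemma has_diffX2 a x v l : has_diff a x v l ->
  has_diff (fun q => a q ^+ 2) x v (2 * a x * l).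
Proof.
move=> ha; rewrite (_ : _ * _ = a x * l + a x * l); last by ring.
by under eq_fun do rewrite expr2; exact: has_diffM.
Qed.

Lemma has_diffV a x v l : a x != 0 -> has_diff a x v l ->
  has_diff (fun q => (a q)^-1) x v (- (l / a x ^+ 2)).
Proof.
move=> a0 [da <-]; split; first exact: differentiableV.
apply: (etrans (fun_eq_at (diffV da a0) v)).
by rewrite [LHS](mulNr (a x ^- 2)) mulrC.
Qed.

Lemma has_diff_div a b x v l m :
  has_diff a x v l -> has_diff b x v m -> b x != 0 ->
  has_diff (fun q => a q / b q) x v ((l - a x / b x * m) / b x).
Proof.
move=> ha hb b0; have := has_diffM ha (has_diffV b0 hb).
by rewrite (_ : _ + _ = (l - a x / b x * m) / b x)//; field.
Qed.

Lemma has_diffB a b x v l m :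
  has_diff a x v l -> has_diff b x v m ->
  has_diff (fun q => a q - b q) x v (l - m).
Proof. by move=> ha hb; exact: (has_diffD ha (has_diffN hb)). Qed.

Lemma has_diff_eq a x v l m :
  has_diff a x v l -> l = m -> has_diff a x v m.
Proof. by move=> h <-. Qed.

Lemma has_diff_sqrt a x v l : has_diff a x v l -> 0 < a x ->
  has_diff (fun q => Num.sqrt (a q)) x v (l / (2 * Num.sqrt (a x))).
Proof.
move=> [da <-] a0; have [ds E] := diff_sqrt a0 da; split=> //.
by rewrite mulrC; exact: (fun_eq_at E).
Qed.

End Directional.

Lemma has_diff_coord (R : realType) n (q u : 'rV[R]_n) i :
  has_diff (fun p : 'rV[R]_n => p 0 i) q u (u 0 i).
Proof. by split; [exact: differentiable_coord|exact: diff_coord]. Qed.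

(** * Symplectic maps of four-space *)

Section Vec4.
Context {R : realType}.
Local Notation R4 := 'rV[R]_4.

Definition vec4 (a b c d : R) : R4 := \row_i nth 0 [:: a; b; c; d] i.

Lemma vec4E (a b c d : R) : (x1 (vec4 a b c d) = a) * (y1 (vec4 a b c d) = b) *
  (x2 (vec4 a b c d) = c) * (y2 (vec4 a b c d) = d).
Proof. by rewrite /x1 /y1 /x2 /y2 !mxE. Qed.

Lemma vec4_eta (q : R4) : q = vec4 (x1 q) (y1 q) (x2 q) (y2 q).
Proof.
apply/rowP => -[[|[|[|[|//]]]] h]; rewrite mxE /=; congr (q _ _); exact/val_inj.
Qed.

Lemma smooth_on_vec4 (V : normedModType R) (U : set V) (a b c d : V -> R) :
  open U -> (forall k, [/\ Ck_on k U a, Ck_on k U b, Ck_on k U c & Ck_on k U d]) ->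
  smooth_on U (fun q => vec4 (a q) (b q) (c q) (d q)).
Proof.
move=> oU H k; have [ca cb cc cd] := H k; apply: Ck_on_row => // i.
have E (f : V -> R) : Ck_on k U f ->
    (forall x, vec4 (a x) (b x) (c x) (d x) 0 i = f x) ->
    Ck_on k U (fun x => vec4 (a x) (b x) (c x) (d x) 0 i).
  by move=> cf /funext ->.
case: i E => -[|[|[|[|//]]]] hi E.
- by apply: E ca _ => x; rewrite mxE.
- by apply: E cb _ => x; rewrite mxE.
- by apply: E cc _ => x; rewrite mxE.
- by apply: E cd _ => x; rewrite mxE.
Qed.

End Vec4.

Section Symplectic_maps.
Context {R : realType}.
Local Notation R4 := 'rV[R]_4.

Lemma omega_nondegenerate (u : R4) : (forall v, omega u v = 0) -> u = 0.
Proof.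
move=> H; rewrite [u]vec4_eta.
have := H (vec4 0 1 0 0); have := H (vec4 1 0 0 0).
have := H (vec4 0 0 0 1); have := H (vec4 0 0 1 0).
rewrite /omega /wedge !vec4E => h1 h2 h3 h4.
by apply/rowP => -[[|[|[|[|//]]]] h]; rewrite !mxE /=; lra.
Qed.

Lemma omegaBl (u v w : R4) : omega (u - v) w = omega u w - omega v w.
Proof. by rewrite /omega /wedge /x1 /y1 /x2 /y2 !mxE; ring. Qed.

(** A kernel vector of the differential would be [omega]-orthogonal to everything. *)
Lemma symplectic_immersion (U : set R4) (F : R4 -> R4) : preserves_omega U F ->
  forall p, U p -> injective ('d F p).
Proof.
move=> FU p Up u v uv; apply/subr0_eq/omega_nondegenerate => w.
by rewrite omegaBl -(FU p Up u w) -(FU p Up v w) uv subrr.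
Qed.

(** The inverse symplectomorphism is the continuous inverse that an embedding
requires. *)
Lemma symplectomorphic_embeds (U V : set R4) :
  symplectomorphic U V -> symplectically_embeds U V.
Proof.
move=> [F [G [[sF sG] [FU GV] [FK GK] oF]]]; exists F; split=> //.
split=> //; first exact: symplectic_immersion oF.
  exact: can_in_inj FK.
exists G; split; last by move=> x Ux; apply: FK; rewrite inE.
apply: continuous_in_subspaceT => y; rewrite inE => FUy.
exact: (sG 0%N y (FU y FUy)).
Qed.

End Symplectic_maps.

(** * The explicit map and its inverse *)

Section Maps.
Context {R : realType}.
Local Notation R4 := 'rV[R]_4.
Implicit Types (q w : R4).

Definition rho q := y1 q ^+ 2 + y2 q ^+ 2.
Definition dot q := x1 q * y1 q + x2 q * y2 q.
Definition ang q := x1 q * y2 q - x2 q * y1 q.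
(** The length of the SO(3) moment map: by the identity in [mu_arg_gt], its square
is ang^2 + rho (2 - |x|^2 - rho), the sum of the squared components. *)
Definition mu q := Num.sqrt (2 * rho q - rho q ^+ 2 - dot q ^+ 2).
Definition tau q := Num.sqrt (1 + mu q).
(** [hre + i him] is the function h, which depends on [rho] and [dot] only. *)
Definition hre q := (mu q ^+ 2 - rho q) / (rho q * tau q).
Definition him q := mu q * dot q / (rho q * tau q).
(** The modulus of w2 divided by |y|, so that w2 is [amp] times the conjugate
of y. *)
Definition amp q := Num.sqrt (2 * (mu q + ang q) / rho q).

(** The factor e^(- 2 i phi) in w1 is the square of the conjugate of y, divided
by rho. *)
Definition Phi q := vec4
  ((hre q * (y1 q ^+ 2 - y2 q ^+ 2) + him q * (2 * y1 q * y2 q)) / rho q)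
  ((him q * (y1 q ^+ 2 - y2 q ^+ 2) - hre q * (2 * y1 q * y2 q)) / rho q)
  (amp q * y1 q)
  (- (amp q * y2 q)).

Definition rad w := x2 w ^+ 2 + y2 w ^+ 2.

(** From here on a primed name, except [amp'], denotes the function on the ellipsoid
that corresponds under [Phi] to the unprimed function on the ball. *)
Definition mu' w := 1 - (x1 w ^+ 2 + y1 w ^+ 2).
Definition tau' w := Num.sqrt (1 + mu' w).
(** h = w1 e^(2 i phi), where e^(i phi) is the conjugate of w2 over its modulus. *)
Definition hre' w :=
  (x1 w * (x2 w ^+ 2 - y2 w ^+ 2) + y1 w * (2 * x2 w * y2 w)) / rad w.
Definition him' w :=
  (y1 w * (x2 w ^+ 2 - y2 w ^+ 2) - x1 w * (2 * x2 w * y2 w)) / rad w.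
(** Solves hre = (mu^2 - rho) / (rho tau) for rho. *)
Definition rho' w := mu' w ^+ 2 / (1 + hre' w * tau' w).
Definition dot' w := him' w * tau' w * rho' w / mu' w.
Definition ang' w := rad w / 2 - mu' w.
(** The inverse of [amp]: the conjugate of y is w2 times |y| / |w2|. *)
Definition amp' w := Num.sqrt (rho' w / rad w).

(** The first and third coordinates are the real and imaginary parts of
x = (dot' - i ang') y / rho'. *)
Definition Psi w := vec4
  ((dot' w * (amp' w * x2 w) - ang' w * (amp' w * y2 w)) / rho' w)
  (amp' w * x2 w)
  ((- dot' w * (amp' w * y2 w) - ang' w * (amp' w * x2 w)) / rho' w)
  (- (amp' w * y2 w)).

Definition source := [set q : R4 | x1 q ^+ 2 + x2 q ^+ 2 + rho q < 2 /\ 0 < rho q].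
Definition target := [set w : R4 | x1 w ^+ 2 + y1 w ^+ 2 + rad w / 4 < 1 /\ 0 < rad w].

Lemma sum_sqr_gt0 (a b : R) : (0 < a ^+ 2 + b ^+ 2) <-> ~ (a = 0 /\ b = 0).
Proof.
split=> [h [a0 b0]|h]; first by move: h; rewrite a0 b0; lra.
rewrite lt0r addr_ge0 ?sqr_ge0// andbT paddr_eq0 ?sqr_ge0// !sqrf_eq0.
by apply/negP => /andP[/eqP ? /eqP ?]; exact: h.
Qed.

Lemma sourceE : ball4 (2 * pi) `\` @lagrangian_disk R = source.
Proof.
rewrite /lagrangian_disk setDIr setDv set0U ball4E; apply/seteqP.
split=> q /= [h /sum_sqr_gt0 r0]; split=> //; move: h; rewrite /rho; lra.
Qed.

Lemma targetE : ellipsoid pi (4 * pi) `\` @symplectic_disk R = target.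
Proof.
rewrite /symplectic_disk setDIr setDv set0U ellipsoidE; apply/seteqP.
by split=> q /= [h /sum_sqr_gt0 r0].
Qed.

Section OnSource.
Variable q : R4.
Hypothesis dq : source q.

Lemma rho_gt0 : 0 < rho q. Proof. by case: dq. Qed.

(** By Lagrange's identity dot^2 + ang^2 = |x|^2 rho, the gap between the two sides
is rho (2 - |x|^2 - rho): inside the ball and off L, the moment map is longer
than its axial component. *)
Lemma mu_arg_gt : ang q ^+ 2 < 2 * rho q - rho q ^+ 2 - dot q ^+ 2.
Proof.
case: dq => h r0.
rewrite -subr_gt0 (_ : _ - _ = rho q * (2 - (x1 q ^+ 2 + x2 q ^+ 2 + rho q))).
  by rewrite mulr_gt0// subr_gt0.
rewrite /ang /dot /rho; ring.
Qed.

Lemma mu_arg_gt0 : 0 < 2 * rho q - rho q ^+ 2 - dot q ^+ 2.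
Proof. exact: le_lt_trans (sqr_ge0 _) mu_arg_gt. Qed.

Lemma sqr_mu : mu q ^+ 2 = 2 * rho q - rho q ^+ 2 - dot q ^+ 2.
Proof. by rewrite sqr_sqrtr// ltW// mu_arg_gt0. Qed.

Lemma mu_gt0 : 0 < mu q.
Proof. by rewrite sqrtr_gt0 mu_arg_gt0. Qed.

Lemma ang_mu : `|ang q| < mu q.
Proof.
rewrite -(@ltr_pXn2r _ 2)// ?nnegrE ?normr_ge0 ?ltW ?mu_gt0//.
by rewrite real_normK ?num_real// sqr_mu mu_arg_gt.
Qed.

Lemma muDang_gt0 : 0 < mu q + ang q.
Proof. by have := ang_mu; rewrite ltr_norml => /andP[]; lra. Qed.

Lemma tau_gt0 : 0 < tau q.
Proof. rewrite sqrtr_gt0; have := mu_gt0; lra. Qed.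

Lemma sqr_tau : tau q ^+ 2 = 1 + mu q.
Proof. rewrite sqr_sqrtr//; have := mu_gt0; lra. Qed.

Lemma amp_arg_gt0 : 0 < 2 * (mu q + ang q) / rho q.
Proof. by rewrite divr_gt0 ?rho_gt0// mulr_gt0// muDang_gt0. Qed.

Lemma amp_gt0 : 0 < amp q.
Proof. by rewrite sqrtr_gt0 amp_arg_gt0. Qed.

Lemma sqr_amp : amp q ^+ 2 = 2 * (mu q + ang q) / rho q.
Proof. by rewrite sqr_sqrtr// ltW// amp_arg_gt0. Qed.

Lemma sqr_h : hre q ^+ 2 + him q ^+ 2 = 1 - mu q.
Proof.
have dE : dot q ^+ 2 = 2 * rho q - rho q ^+ 2 - mu q ^+ 2 by rewrite sqr_mu; ring.
have := sqr_tau; rewrite /hre /him; move: dE rho_gt0 tau_gt0 mu_gt0.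
move: (dot q) (mu q) (tau q) (rho q) => p m t r dE r0 t0 m0 tE.
have {}r0 : r != 0 by rewrite gt_eqF.
have {}t0 : t != 0 by rewrite gt_eqF.
(* replacing t^2 by 1 + m puts 1 + m in a denominator *)
have m1 : 1 + m != 0 by rewrite gt_eqF//; lra.
field: dE tE; by rewrite r0 t0.
Qed.

Lemma Phi_r1 : x1 (Phi q) ^+ 2 + y1 (Phi q) ^+ 2 = 1 - mu q.
Proof.
rewrite -sqr_h !vec4E; have := rho_gt0; rewrite /rho.
move: (y1 q) (y2 q) (hre q) (him q) => a b u v r0; have {}r0 := lt0r_neq0 r0.
field; exact: r0.
Qed.

Lemma Phi_rad : rad (Phi q) = 2 * (mu q + ang q).
Proof.
rewrite /rad !vec4E sqrrN !exprMn -mulrDr sqr_amp.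
by rewrite -/(rho q) divfK// gt_eqF// rho_gt0.
Qed.

Lemma Phi_target : target (Phi q).
Proof.
split=> /=; rewrite Phi_rad; last by have := muDang_gt0; lra.
by rewrite Phi_r1; have := ang_mu; rewrite ltr_norml => /andP[]; lra.
Qed.

Lemma PhiK : Psi (Phi q) = q.
Proof.
have r0 := lt0r_neq0 rho_gt0; have m0 := lt0r_neq0 mu_gt0.
have t0 := lt0r_neq0 tau_gt0; have a0 := lt0r_neq0 amp_gt0.
have mE : mu' (Phi q) = mu q by rewrite /mu' Phi_r1; ring.
have tE : tau' (Phi q) = tau q by rewrite /tau' mE.
have rdE : rad (Phi q) = amp q ^+ 2 * rho q by rewrite Phi_rad sqr_amp divfK.
have uE : hre' (Phi q) = hre q.
  rewrite /hre' rdE !vec4E; move: r0 a0; rewrite /rho.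
  move: (y1 q) (y2 q) (hre q) (him q) (amp q) => a b u v A r0 a0.
  field; by rewrite a0 r0.
have vE : him' (Phi q) = him q.
  rewrite /him' rdE !vec4E; move: r0 a0; rewrite /rho.
  move: (y1 q) (y2 q) (hre q) (him q) (amp q) => a b u v A r0 a0.
  field; by rewrite a0 r0.
have rE : rho' (Phi q) = rho q.
  rewrite /rho' mE tE uE /hre (_ : 1 + _ = mu q ^+ 2 / rho q).
    by field; rewrite r0 m0.
  by field; rewrite r0 t0.
have dE : dot' (Phi q) = dot q.
  by rewrite /dot' vE tE rE mE /him; field; rewrite r0 t0 m0.
have aE : ang' (Phi q) = ang q by rewrite /ang' Phi_rad mE; field.
have gE : amp' (Phi q) = (amp q)^-1.
  rewrite /amp' rE rdE invfM mulrCA divff// mulr1.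
  by rewrite -exprVn sqrtr_sqr ger0_norm// invr_ge0 ltW// amp_gt0.
rewrite [RHS]vec4_eta /Psi rE dE aE gE !vec4E.
congr vec4; rewrite ?mulKf ?mulNr ?mulrN ?opprK ?mulKf//.
- by move: r0; rewrite /ang /dot /rho => r0; field.
- by move: r0; rewrite /ang /dot /rho => r0; field.
Qed.

End OnSource.

Section OnTarget.
Variable w : R4.
Hypothesis dw : target w.

Lemma rad_gt0 : 0 < rad w. Proof. by case: dw. Qed.

Lemma mu'_gt : rad w < 4 * mu' w.
Proof. by case: dw => h _; rewrite /mu'; move: h; lra. Qed.

Lemma mu'_gt0 : 0 < mu' w.
Proof. have := rad_gt0; have := mu'_gt; lra. Qed.

Lemma tau'_gt0 : 0 < tau' w.
Proof. rewrite sqrtr_gt0; have := mu'_gt0; lra. Qed.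

Lemma sqr_tau' : tau' w ^+ 2 = 1 + mu' w.
Proof. rewrite sqr_sqrtr//; have := mu'_gt0; lra. Qed.

Lemma sqr_h' : hre' w ^+ 2 + him' w ^+ 2 = 1 - mu' w.
Proof.
rewrite /hre' /him' /mu'; have := lt0r_neq0 rad_gt0; rewrite /rad.
move: (x1 w) (y1 w) (x2 w) (y2 w) => a b c d r0.
by field.
Qed.

(** From hre^2 <= 1 - mu and tau^2 = 1 + mu one gets (hre tau)^2 <= 1 - mu^2 < 1. *)
Lemma den_gt0 : 0 < 1 + hre' w * tau' w.
Proof.
suff : `|hre' w * tau' w| < 1 by rewrite ltr_norml => /andP[]; lra.
rewrite -(@ltr_pXn2r _ 2)// ?nnegrE// real_normK ?num_real// expr1n.
apply: (@le_lt_trans _ _ ((1 - mu' w) * (1 + mu' w))).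
  rewrite exprMn sqr_tau' ler_wpM2r//; first by have := mu'_gt0; lra.
  by rewrite -sqr_h' lerDl sqr_ge0.
have m2 : 0 < mu' w ^+ 2 by rewrite exprn_gt0// mu'_gt0.
rewrite (_ : _ * _ = 1 - mu' w ^+ 2); [lra | ring].
Qed.

Lemma rho'_gt0 : 0 < rho' w.
Proof. by rewrite divr_gt0 ?den_gt0// exprn_gt0// mu'_gt0. Qed.

(** With a = 1 + hre' tau' and b = him' tau', the norm of h gives
(a - 1)^2 + b^2 = 1 - mu'^2; substituting rho' = mu'^2 / a and
dot' = b mu' / a turns this into the relation that defines [mu]. *)
Lemma sqr_mu' : 2 * rho' w - rho' w ^+ 2 - dot' w ^+ 2 = mu' w ^+ 2.
Proof.
have m0 := lt0r_neq0 mu'_gt0; have D0 := lt0r_neq0 den_gt0.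
have uE : him' w ^+ 2 = 1 - mu' w - hre' w ^+ 2 by rewrite -sqr_h'; ring.
have := sqr_tau'; move: D0 uE m0; rewrite /dot' /rho'.
move: (hre' w) (him' w) (tau' w) (mu' w) => u v t m D0 vE m0 tE.
by field: vE tE; rewrite D0 m0.
Qed.

Lemma amp'_arg_gt0 : 0 < rho' w / rad w.
Proof. by rewrite divr_gt0 ?rho'_gt0 ?rad_gt0. Qed.

Lemma amp'_gt0 : 0 < amp' w.
Proof. by rewrite sqrtr_gt0 amp'_arg_gt0. Qed.

Lemma sqr_amp' : amp' w ^+ 2 = rho' w / rad w.
Proof. by rewrite sqr_sqrtr// ltW// amp'_arg_gt0. Qed.

Lemma rho_Psi : rho (Psi w) = rho' w.
Proof.
rewrite /rho !vec4E sqrrN !exprMn -mulrDr sqr_amp' -/(rad w) divfK//.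
exact: lt0r_neq0 rad_gt0.
Qed.

Lemma dot_Psi : dot (Psi w) = dot' w.
Proof.
have r0 := lt0r_neq0 rho'_gt0.
have aE : rho' w = (amp' w * x2 w) ^+ 2 + (amp' w * y2 w) ^+ 2.
  by rewrite -rho_Psi /rho !vec4E sqrrN.
rewrite /dot !vec4E aE; rewrite aE in r0; move: r0.
move: (amp' w * x2 w) (amp' w * y2 w) (dot' w) (ang' w) => a b d j r0.
by field.
Qed.

Lemma ang_Psi : ang (Psi w) = ang' w.
Proof.
have r0 := lt0r_neq0 rho'_gt0.
have aE : rho' w = (amp' w * x2 w) ^+ 2 + (amp' w * y2 w) ^+ 2.
  by rewrite -rho_Psi /rho !vec4E sqrrN.
rewrite /ang !vec4E aE; rewrite aE in r0; move: r0.
move: (amp' w * x2 w) (amp' w * y2 w) (dot' w) (ang' w) => a b d j r0.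
by field.
Qed.

Lemma mu_Psi : mu (Psi w) = mu' w.
Proof. by rewrite /mu rho_Psi dot_Psi sqr_mu' sqrtr_sqr gtr0_norm// mu'_gt0. Qed.

(** The argument of [mu_arg_gt] read backwards: the bound needed is
ang'^2 < mu'^2, that is, 0 < rad < 4 mu'. *)
Lemma Psi_source : source (Psi w).
Proof.
have r0 := rho'_gt0; split=> /=; rewrite rho_Psi//.
rewrite -subr_gt0 -(pmulr_rgt0 _ r0).
rewrite (_ : _ * _ = (2 * rho' w - rho' w ^+ 2 - dot' w ^+ 2) - ang' w ^+ 2); last first.
  by rewrite -rho_Psi -dot_Psi -ang_Psi /rho /dot /ang; ring.
rewrite sqr_mu' /ang' (_ : _ - _ = rad w * (mu' w - rad w / 4)); last by field.
by rewrite mulr_gt0 ?rad_gt0//; have := mu'_gt; lra.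
Qed.

Lemma PsiK : Phi (Psi w) = w.
Proof.
have r0 := lt0r_neq0 rho'_gt0; have m0 := lt0r_neq0 mu'_gt0.
have t0 := lt0r_neq0 tau'_gt0; have a0 := lt0r_neq0 amp'_gt0.
have R0 := lt0r_neq0 rad_gt0; have D0 := lt0r_neq0 den_gt0.
have tE : tau (Psi w) = tau' w by rewrite /tau mu_Psi.
have uE : hre (Psi w) = hre' w.
  rewrite /hre mu_Psi rho_Psi tE /rho'.
  by field; rewrite t0 D0 m0.
have vE : him (Psi w) = him' w.
  by rewrite /him mu_Psi dot_Psi rho_Psi tE /dot'; field; rewrite r0 t0 m0.
have gE : amp (Psi w) = (amp' w)^-1.
  rewrite /amp mu_Psi ang_Psi rho_Psi /ang'.
  rewrite (_ : _ / _ = (amp' w)^-1 ^+ 2); last first.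
    by rewrite exprVn sqr_amp'; field; rewrite r0 R0.
  by rewrite sqrtr_sqr ger0_norm// invr_ge0 ltW// amp'_gt0.
have rE : rho' w = amp' w ^+ 2 * rad w by rewrite sqr_amp' divfK.
rewrite [RHS]vec4_eta /Phi uE vE gE rho_Psi rE !vec4E.
congr vec4; rewrite ?mulrN ?opprK ?mulKf// /hre' /him'; move: R0; rewrite /rad => R0.
- by field; rewrite a0 R0.
- by field; rewrite a0 R0.
Qed.

End OnTarget.
End Maps.

(** * Smoothness of the two maps *)

Section Smooth.
Context {R : realType}.

Lemma open_source : open (@source R).
Proof. by rewrite -sourceE; exact: open_ball4_minus_disk. Qed.

Lemma open_target : open (@target R).
Proof. by rewrite -targetE; exact: open_ellipsoid_minus_disk. Qed.

Lemma smooth_Phi : smooth_on (@source R) (@Phi R).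
Proof.
have oU := open_source; apply: smooth_on_vec4 => // k.
set U := @source R in oU *.
have cc (c : R) : Ck_on k U (fun=> c) by exact: Ck_on_cst.
have cx1 : Ck_on k U (@x1 R) by exact: Ck_on_coord.
have cy1 : Ck_on k U (@y1 R) by exact: Ck_on_coord.
have cx2 : Ck_on k U (@x2 R) by exact: Ck_on_coord.
have cy2 : Ck_on k U (@y2 R) by exact: Ck_on_coord.
have Y1 := Ck_onX2 oU cy1; have Y2 := Ck_onX2 oU cy2.
have cr : Ck_on k U (@rho R) := Ck_onD oU Y1 Y2.
have cd : Ck_on k U (@dot R) := Ck_onD oU (Ck_onM oU cx1 cy1) (Ck_onM oU cx2 cy2).
have cj : Ck_on k U (@ang R) := Ck_onB oU (Ck_onM oU cx1 cy2) (Ck_onM oU cx2 cy1).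
have r0 q (Uq : U q) : rho q != 0 := lt0r_neq0 (rho_gt0 Uq).
have cm : Ck_on k U (@mu R).
  exact: (Ck_on_sqrt oU (@mu_arg_gt0 R) (Ck_onB oU (Ck_onB oU
    (Ck_onM oU (cc 2) cr) (Ck_onX2 oU cr)) (Ck_onX2 oU cd))).
have ct : Ck_on k U (@tau R).
  apply: (Ck_on_sqrt oU _ (Ck_onD oU (cc 1) cm)) => q Uq.
  by have := mu_gt0 Uq; lra.
have rt0 q (Uq : U q) : rho q * tau q != 0.
  by rewrite mulf_neq0 ?r0 ?lt0r_neq0 ?(tau_gt0 Uq).
have crt := Ck_onM oU cr ct.
have cu : Ck_on k U (@hre R) := Ck_on_div oU rt0 (Ck_onB oU (Ck_onX2 oU cm) cr) crt.
have cv : Ck_on k U (@him R) := Ck_on_div oU rt0 (Ck_onM oU cm cd) crt.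
have ca : Ck_on k U (@amp R).
  exact: (Ck_on_sqrt oU (@amp_arg_gt0 R)
    (Ck_on_div oU r0 (Ck_onM oU (cc 2) (Ck_onD oU cm cj)) cr)).
have cC := Ck_onB oU Y1 Y2.
have cS := Ck_onM oU (Ck_onM oU (cc 2) cy1) cy2.
split.
- exact: (Ck_on_div oU r0 (Ck_onD oU (Ck_onM oU cu cC) (Ck_onM oU cv cS)) cr).
- exact: (Ck_on_div oU r0 (Ck_onB oU (Ck_onM oU cv cC) (Ck_onM oU cu cS)) cr).
- exact: (Ck_onM oU ca cy1).
- exact: (Ck_onN oU (Ck_onM oU ca cy2)).
Qed.

Lemma smooth_Psi : smooth_on (@target R) (@Psi R).
Proof.
have oU := open_target; apply: smooth_on_vec4 => // k.
set U := @target R in oU *.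
have cc (c : R) : Ck_on k U (fun=> c) by exact: Ck_on_cst.
have cx1 : Ck_on k U (@x1 R) by exact: Ck_on_coord.
have cy1 : Ck_on k U (@y1 R) by exact: Ck_on_coord.
have cx2 : Ck_on k U (@x2 R) by exact: Ck_on_coord.
have cy2 : Ck_on k U (@y2 R) by exact: Ck_on_coord.
have X2 := Ck_onX2 oU cx2; have Y2 := Ck_onX2 oU cy2.
have cr : Ck_on k U (@rad R) := Ck_onD oU X2 Y2.
have cm : Ck_on k U (@mu' R) :=
  Ck_onB oU (cc 1) (Ck_onD oU (Ck_onX2 oU cx1) (Ck_onX2 oU cy1)).
have r0 q (Uq : U q) : rad q != 0 := lt0r_neq0 (rad_gt0 Uq).
have m0 q (Uq : U q) : mu' q != 0 := lt0r_neq0 (mu'_gt0 Uq).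
have D0 q (Uq : U q) : 1 + hre' q * tau' q != 0 := lt0r_neq0 (den_gt0 Uq).
have rho0 q (Uq : U q) : rho' q != 0 := lt0r_neq0 (rho'_gt0 Uq).
have ct : Ck_on k U (@tau' R).
  apply: (Ck_on_sqrt oU _ (Ck_onD oU (cc 1) cm)) => q Uq.
  by have := mu'_gt0 Uq; lra.
have cC := Ck_onB oU X2 Y2.
have cS := Ck_onM oU (Ck_onM oU (cc 2) cx2) cy2.
have cu : Ck_on k U (@hre' R) :=
  Ck_on_div oU r0 (Ck_onD oU (Ck_onM oU cx1 cC) (Ck_onM oU cy1 cS)) cr.
have cv : Ck_on k U (@him' R) :=
  Ck_on_div oU r0 (Ck_onB oU (Ck_onM oU cy1 cC) (Ck_onM oU cx1 cS)) cr.
have crho : Ck_on k U (@rho' R) :=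
  Ck_on_div oU D0 (Ck_onX2 oU cm) (Ck_onD oU (cc 1) (Ck_onM oU cu ct)).
have cd : Ck_on k U (@dot' R) :=
  Ck_on_div oU m0 (Ck_onM oU (Ck_onM oU cv ct) crho) cm.
have cj : Ck_on k U (@ang' R).
  by apply: (Ck_onB oU (Ck_on_div oU _ cr (cc 2)) cm) => q _ /=; rewrite pnatr_eq0.
have ca : Ck_on k U (@amp' R) :=
  Ck_on_sqrt oU (@amp'_arg_gt0 R) (Ck_on_div oU r0 crho cr).
have cp := Ck_onM oU ca cx2; have cq := Ck_onM oU ca cy2.
split.
- exact: (Ck_on_div oU rho0 (Ck_onB oU (Ck_onM oU cd cp) (Ck_onM oU cj cq)) crho).
- exact: cp.
- exact: (Ck_on_div oU rho0
    (Ck_onB oU (Ck_onM oU (Ck_onN oU cd) cq) (Ck_onM oU cj cp)) crho).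
- exact: (Ck_onN oU cq).
Qed.

End Smooth.

(** * Invariance of the symplectic form *)

Section Forms.
Context {R : realType}.

(** In the lemmas below the prefixes d and e mark the values of a 1-form on two
tangent vectors, and dX eY - eX dY is the value of the 2-form dX ^ dY.

The area form of h.  The two other identities differentiate |h|^2 = 1 - mu. *)
Lemma wedge_profile (r p m t dr dp er ep : R) : r != 0 -> m != 0 -> t != 0 ->
  m ^+ 2 = 2 * r - r ^+ 2 - p ^+ 2 -> t ^+ 2 = 1 + m ->
  let dm := (dr - r * dr - p * dp) / m in
  let em := (er - r * er - p * ep) / m in
  let dt := dm / (2 * t) in let et := em / (2 * t) in
  let u := (m ^+ 2 - r) / (r * t) in
  let v := m * p / (r * t) in
  let du := (2 * m * dm - dr - u * (dr * t + r * dt)) / (r * t) in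
  let eu := (2 * m * em - er - u * (er * t + r * et)) / (r * t) in
  let dv := (m * dp + p * dm - v * (dr * t + r * dt)) / (r * t) in
  let ev := (m * ep + p * em - v * (er * t + r * et)) / (r * t) in
  [/\ du * ev - eu * dv = (dp * er - ep * dr) / (2 * r),
      2 * (u * du + v * dv) = - dm & 2 * (u * eu + v * ev) = - em].
Proof.
move=> r0 m0 t0 mE tE /=.
have pE : p ^+ 2 = 2 * r - r ^+ 2 - m ^+ 2 by rewrite mE; ring.
by split; field: pE tE; rewrite t0 r0 m0.
Qed.

(** Rotating h = u + i v by - 2 phi adds to its area form the term
- d (|h|^2) ^ d phi; [df] and [ef] are the values of d phi. *)
Lemma wedge_twist (y z u v dy dz du dv ey ez eu ev : R) :
  y ^+ 2 + z ^+ 2 != 0 ->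
  let r := y ^+ 2 + z ^+ 2 in
  let dr := 2 * (y * dy + z * dz) in let er := 2 * (y * ey + z * ez) in
  let C := y ^+ 2 - z ^+ 2 in let S := 2 * y * z in
  let dC := 2 * (y * dy - z * dz) in let eC := 2 * (y * ey - z * ez) in
  let dS := 2 * (y * dz + z * dy) in let eS := 2 * (y * ez + z * ey) in
  let X := (u * C + v * S) / r in let Y := (v * C - u * S) / r in
  let dX := (du * C + u * dC + dv * S + v * dS - X * dr) / r in
  let eX := (eu * C + u * eC + ev * S + v * eS - X * er) / r in
  let dY := (dv * C + v * dC - du * S - u * dS - Y * dr) / r in
  let eY := (ev * C + v * eC - eu * S - u * eS - Y * er) / r in
  let df := (y * dz - z * dy) / r in let ef := (y * ez - z * ey) / r in
  let dm := - (2 * (u * du + v * dv)) in let em := - (2 * (u * eu + v * ev)) in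
  dX * eY - eX * dY = (du * ev - eu * dv) + (dm * ef - em * df).
Proof. by move=> r0 /=; field. Qed.

(** The area form of w2 is - d (|w2|^2 / 2) ^ d phi, and |w2|^2 = A^2 r; [ds] and [es]
are the values of d (A^2 r / 2). *)
Lemma wedge_amp (y z A dy dz ds ey ez es : R) :
  y ^+ 2 + z ^+ 2 != 0 -> A != 0 ->
  let r := y ^+ 2 + z ^+ 2 in
  let dr := 2 * (y * dy + z * dz) in let er := 2 * (y * ey + z * ez) in
  let dA := (2 * ds - A ^+ 2 * dr) / (2 * A * r) in
  let eA := (2 * es - A ^+ 2 * er) / (2 * A * r) in
  let dX := A * dy + y * dA in let eX := A * ey + y * eA in
  let dY := - (A * dz + z * dA) in let eY := - (A * ez + z * eA) in
  let df := (y * dz - z * dy) / r in let ef := (y * ez - z * ey) / r in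
  dX * eY - eX * dY = - (ds * ef - es * df).
Proof. by move=> r0 A0 /=; field; rewrite r0 A0. Qed.

(** [omega] in the coordinates (dot, rho, ang, phi), with (x1, x2, y1, y2) written
(x, w, y, z). *)
Lemma wedge_polar (x w y z dx dw dy dz ex ew ey ez : R) :
  y ^+ 2 + z ^+ 2 != 0 ->
  let r := y ^+ 2 + z ^+ 2 in
  let dr := 2 * (y * dy + z * dz) in let er := 2 * (y * ey + z * ez) in
  let dp := x * dy + y * dx + (w * dz + z * dw) in
  let ep := x * ey + y * ex + (w * ez + z * ew) in
  let dj := x * dz + z * dx - (w * dy + y * dw) in
  let ej := x * ez + z * ex - (w * ey + y * ew) in
  let df := (y * dz - z * dy) / r in let ef := (y * ez - z * ey) / r in
  (dp * er - ep * dr) / (2 * r) - (dj * ef - ej * df) =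
  (dx * ey - ex * dy) + (dw * ez - ew * dz).
Proof. by move=> r0 /=; field. Qed.

End Forms.

Section Symplectic.
Context {R : realType}.
Local Notation R4 := 'rV[R]_4.

(** The differentials at [q] evaluated at [u].  Those of the square roots are
obtained from the relations satisfied by mu^2, tau^2 and amp^2. *)
Definition drho (q u : R4) : R := 2 * (y1 q * y1 u + y2 q * y2 u).
Definition ddot (q u : R4) : R :=
  x1 q * y1 u + y1 q * x1 u + (x2 q * y2 u + y2 q * x2 u).
Definition dang (q u : R4) : R :=
  x1 q * y2 u + y2 q * x1 u - (x2 q * y1 u + y1 q * x2 u).
Definition dmu (q u : R4) : R :=
  (drho q u - rho q * drho q u - dot q * ddot q u) / mu q.
Definition dtau (q u : R4) : R := dmu q u / (2 * tau q).
Definition dhre (q u : R4) : R := (2 * mu q * dmu q u - drho q u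
  - hre q * (drho q u * tau q + rho q * dtau q u)) / (rho q * tau q).
Definition dhim (q u : R4) : R := (mu q * ddot q u + dot q * dmu q u
  - him q * (drho q u * tau q + rho q * dtau q u)) / (rho q * tau q).
Definition damp (q u : R4) : R := (2 * (dmu q u + dang q u) - amp q ^+ 2 * drho q u)
  / (2 * amp q * rho q).

Section AtPoint.
Variables q u : R4.
Hypothesis dq : source q.

Let hx1 : has_diff (@x1 R) q u (x1 u) := has_diff_coord _ _ _.
Let hy1 : has_diff (@y1 R) q u (y1 u) := has_diff_coord _ _ _.
Let hx2 : has_diff (@x2 R) q u (x2 u) := has_diff_coord _ _ _.
Let hy2 : has_diff (@y2 R) q u (y2 u) := has_diff_coord _ _ _.
Let hc (c : R) : has_diff (fun=> c) q u 0 := has_diff_cst c q u.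
Let r0 := lt0r_neq0 (rho_gt0 dq).
Let m0 := lt0r_neq0 (mu_gt0 dq).
Let t0 := lt0r_neq0 (tau_gt0 dq).
Let a0 := lt0r_neq0 (amp_gt0 dq).

Lemma has_diff_rho : has_diff (@rho R) q u (drho q u).
Proof.
apply: (has_diff_eq (has_diffD (has_diffX2 hy1) (has_diffX2 hy2))).
by rewrite /drho; ring.
Qed.

Lemma has_diff_dot : has_diff (@dot R) q u (ddot q u).
Proof. exact: (has_diffD (has_diffM hx1 hy1) (has_diffM hx2 hy2)). Qed.

Lemma has_diff_ang : has_diff (@ang R) q u (dang q u).
Proof. exact: (has_diffB (has_diffM hx1 hy2) (has_diffM hx2 hy1)). Qed.

Lemma has_diff_mu : has_diff (@mu R) q u (dmu q u).
Proof.
apply: (has_diff_eq (has_diff_sqrt (has_diffB (has_diffB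
  (has_diffM (hc 2) has_diff_rho) (has_diffX2 has_diff_rho))
  (has_diffX2 has_diff_dot)) (mu_arg_gt0 dq))).
by rewrite -/(mu q) /dmu; field.
Qed.

Lemma has_diff_tau : has_diff (@tau R) q u (dtau q u).
Proof.
have h : 0 < 1 + mu q by have := mu_gt0 dq; lra.
apply: (has_diff_eq (has_diff_sqrt (has_diffD (hc 1) has_diff_mu) h)).
by rewrite -/(tau q) add0r.
Qed.

Let hrt := has_diffM has_diff_rho has_diff_tau.
Let rt0 : rho q * tau q != 0. Proof. by rewrite mulf_neq0. Qed.

Lemma has_diff_hre : has_diff (@hre R) q u (dhre q u).
Proof.
apply: (has_diff_eq (has_diff_div
  (has_diffB (has_diffX2 has_diff_mu) has_diff_rho) hrt rt0)).
by rewrite -/(hre q) /dhre; field; rewrite r0 t0.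
Qed.

Lemma has_diff_him : has_diff (@him R) q u (dhim q u).
Proof.
apply: (has_diff_eq (has_diff_div (has_diffM has_diff_mu has_diff_dot) hrt rt0)).
by rewrite -/(him q) /dhim; field; rewrite r0 t0.
Qed.

Lemma has_diff_amp : has_diff (@amp R) q u (damp q u).
Proof.
apply: (has_diff_eq (has_diff_sqrt (has_diff_div
  (has_diffM (hc 2) (has_diffD has_diff_mu has_diff_ang)) has_diff_rho r0)
  (amp_arg_gt0 dq))).
by rewrite -/(amp q) /damp (sqr_amp dq); field; rewrite r0 a0.
Qed.

Definition dC (q u : R4) : R := 2 * (y1 q * y1 u - y2 q * y2 u).
Definition dS (q u : R4) : R := 2 * (y1 q * y2 u + y2 q * y1 u).

Let hC : has_diff (fun q => y1 q ^+ 2 - y2 q ^+ 2) q u (dC q u).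
Proof.
apply: (has_diff_eq (has_diffB (has_diffX2 hy1) (has_diffX2 hy2))).
by rewrite /dC; ring.
Qed.

Let hS : has_diff (fun q => 2 * y1 q * y2 q) q u (dS q u).
Proof.
apply: (has_diff_eq (has_diffM (has_diffM (hc 2) hy1) hy2)).
by rewrite /dS; ring.
Qed.

Lemma diff_Phi_coord i (f : R4 -> R) l : (forall p, Phi p 0 i = f p) ->
  has_diff f q u l -> 'd (@Phi R) q u 0 i = l.
Proof.
move=> /funext E [_ <-]; rewrite -E; apply: diff_row.
exact: (Ck_on_diff (smooth_Phi 1)).
Qed.

Lemma x1_diff_Phi : x1 ('d (@Phi R) q u) =
  (dhre q u * (y1 q ^+ 2 - y2 q ^+ 2) + hre q * dC q u
   + dhim q u * (2 * y1 q * y2 q) + him q * dS q u - x1 (Phi q) * drho q u) / rho q.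
Proof.
apply: diff_Phi_coord; first by move=> p; rewrite mxE.
apply: (has_diff_eq (has_diff_div (has_diffD (has_diffM has_diff_hre hC)
  (has_diffM has_diff_him hS)) has_diff_rho r0)).
by rewrite !vec4E; field.
Qed.

Lemma y1_diff_Phi : y1 ('d (@Phi R) q u) =
  (dhim q u * (y1 q ^+ 2 - y2 q ^+ 2) + him q * dC q u
   - dhre q u * (2 * y1 q * y2 q) - hre q * dS q u - y1 (Phi q) * drho q u) / rho q.
Proof.
apply: diff_Phi_coord; first by move=> p; rewrite mxE.
apply: (has_diff_eq (has_diff_div (has_diffB (has_diffM has_diff_him hC)
  (has_diffM has_diff_hre hS)) has_diff_rho r0)).
by rewrite !vec4E; field.
Qed.

Lemma x2_diff_Phi :
  x2 ('d (@Phi R) q u) = amp q * y1 u + y1 q * damp q u.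
Proof.
apply: diff_Phi_coord; first by move=> p; rewrite mxE.
exact: (has_diffM has_diff_amp hy1).
Qed.

Lemma y2_diff_Phi :
  y2 ('d (@Phi R) q u) = - (amp q * y2 u + y2 q * damp q u).
Proof.
apply: diff_Phi_coord; first by move=> p; rewrite mxE.
exact: (has_diffN (has_diffM has_diff_amp hy2)).
Qed.

End AtPoint.

Lemma Phi_preserves_omega : preserves_omega (@source R) (@Phi R).
Proof.
move=> q dq u v; rewrite /omega /wedge.
rewrite !(x1_diff_Phi _ dq) !(y1_diff_Phi _ dq) !(x2_diff_Phi _ dq) !(y2_diff_Phi _ dq).
have r0 := lt0r_neq0 (rho_gt0 dq).
have [Wuv du dv] := wedge_profile (drho q u) (ddot q u) (drho q v) (ddot q v) r0
  (lt0r_neq0 (mu_gt0 dq)) (lt0r_neq0 (tau_gt0 dq)) (sqr_mu dq) (sqr_tau dq).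
(* The derivatives occurring in [wedge_profile] unfold to [dhre] and [dhim]. *)
have {}Wuv : dhre q u * dhim q v - dhre q v * dhim q u =
  (ddot q u * drho q v - ddot q v * drho q u) / (2 * rho q) := Wuv.
have {}du : 2 * (hre q * dhre q u + him q * dhim q u) = - dmu q u := du.
have {}dv : 2 * (hre q * dhre q v + him q * dhim q v) = - dmu q v := dv.
have W1 := wedge_twist (hre q) (him q) (y1 u) (y2 u) (dhre q u) (dhim q u)
  (y1 v) (y2 v) (dhre q v) (dhim q v) r0.
have W2 := wedge_amp (y1 u) (y2 u) (dmu q u + dang q u)
  (y1 v) (y2 v) (dmu q v + dang q v) r0 (lt0r_neq0 (amp_gt0 dq)).
have W3 := wedge_polar (x1 q) (x2 q) (x1 u) (x2 u) (y1 u) (y2 u)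
  (x1 v) (x2 v) (y1 v) (y2 v) r0.
rewrite !vec4E.
apply: (etrans (congr2 (fun a b : R => a + b) W1 W2)); apply: (etrans _ W3).
rewrite /= -/(rho q) Wuv du dv !opprK.
rewrite -/(drho q u) -/(drho q v) -/(ddot q u) -/(ddot q v) -/(dang q u) -/(dang q v).
by ring.
Qed.

End Symplectic.

Theorem theorem1p3 (R : realType) :
  symplectomorphic (ball4 (2 * pi) `\` @lagrangian_disk R)
                   (ellipsoid pi (4 * pi) `\` @symplectic_disk R) /\
  symplectically_embeds (ball4 (2 * pi) `\` @lagrangian_disk R)
                        (@cylinder R pi).
Proof.
rewrite sourceE targetE.
have S : symplectomorphic (@source R) (@target R).
  exists (@Phi R), (@Psi R); split.
  - by split; [exact: smooth_Phi|exact: smooth_Psi].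
  - by split=> _ [q hq <-]; [exact: Phi_target|exact: Psi_source].
  - by split=> q; rewrite inE => hq; [exact: PhiK|exact: PsiK].
  - exact: Phi_preserves_omega.
split=> //; have [F [eF FU oF]] := symplectomorphic_embeds S.
exists F; split=> //; apply: (subset_trans FU) => w [h r0].
by rewrite cylinderE /=; move: h r0; lra.
Qed.
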